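(* A mixed Steiner system $\mathrm{MS}(1,k,\mathbb{Z}_2^n\times\mathbb{Z}_q)$ exists if and only if $n\ge (k-1)(q-1)$ and $n-(k-1)(q-1)$ is divisible by $k$.
   Context: For integers $q_1,\dots,q_N\ge 2$, $Q=\mathbb{Z}_{q_1}\times\cdots\times\mathbb{Z}_{q_N}$ is viewed as the set of words of length $N$ whose $i$-th letter lies in $\mathbb{Z}_{q_i}$; $\mathbb{Z}_2^n\times\mathbb{Z}_q$ has $n\ge1$ binary coordinates and one coordinate over $\mathbb{Z}_q$, $q\ge 2$. The weight of a word is its number of nonzero coordinates, and $d(\cdot,\cdot)$ is the Hamming distance. For integers $1\le t\le k\le N$, a mixed Steiner system $\mathrm{MS}(t,k,Q)$ is a set $\mathcal{C}$ of words of $Q$ of weight $k$ such that (i) for every word $x\in Q$ of weight $t$ there is exactly one $c\in\mathcal{C}$ with $d(x,c)=k-t$; and (ii) any two distinct elements of $\mathcal{C}$ are at Hamming distance at least $2(k-t)+1$. *)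

(* Defs.v *)
From mathcomp Require Import all_boot all_order all_algebra.
Set Implicit Arguments.
Unset Strict Implicit.
Unset Printing Implicit Defensive.

(* 'Z_m denotes the integers modulo m only when 1 < m; every use of [word q]
   is meant under the hypothesis that all the [q i] are at least 2. *)
Definition word (N : nat) (q : 'I_N -> nat) : Type :=
  {dffun forall i : 'I_N, 'Z_(q i)}.

Definition weight (N : nat) (q : 'I_N -> nat) (x : word q) : nat :=
  #|[set i : 'I_N | x i != 0%R]|.

Definition hamming (N : nat) (q : 'I_N -> nat) (x y : word q) : nat :=
  #|[set i : 'I_N | x i != y i]|.

(* Meant for 1 <= t <= k <= N, so that the subtraction k - t is exact. *)
Record mixed_steiner (N : nat) (q : 'I_N -> nat) (t k : nat)
    (C : {set word q}) : Prop := MixedSteiner {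
  ms_weight : forall c : word q, c \in C -> weight c = k;
  ms_cover : forall x : word q, weight x = t ->
    exists! c : word q, c \in C /\ hamming x c = k - t;
  ms_dist : forall c c' : word q, c \in C -> c' \in C -> c != c' ->
    2 * (k - t) + 1 <= hamming c c' }.

(* Alphabet sizes of Z_2^n x Z_q: the last of the n + 1 coordinates is the one
   over Z_q. *)
Definition binary_and_one (n q : nat) : 'I_n.+1 -> nat :=
  fun i => if i < n then 2 else q.
Arguments binary_and_one : clear implicits.

(* Main.v *)
Require Import Defs.
From mathcomp Require Import all_boot all_order all_algebra.
From mathcomp Require Import zify.

(** A word of weight 1 is a letter [a != 0] at a position [i], and a word [c] of
    weight [k] lies at distance [k - 1] from it exactly when [c i = a].  So the
    codewords partition the [n + (q - 1)] pairs (position, nonzero letter) into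
    blocks of size [k].  Two letters of the last position cannot share a block,
    so [q - 1] blocks contain [k - 1] binary positions each, and the remaining
    blocks partition the other binary positions into sets of size [k].
    Conversely, any such partition is a mixed Steiner system: two disjoint
    codewords are at distance [2 * k], or [2 * k - 1] when they both are nonzero
    at the last position. *)

Lemma weightE (N : nat) (q : 'I_N -> nat) (x : word q) :
  weight x = \sum_i (x i != 0%R).
Proof. by rewrite /weight cardsE -sum1_card big_mkcond. Qed.

Lemma hammingE (N : nat) (q : 'I_N -> nat) (x y : word q) :
  hamming x y = \sum_i (x i != y i).
Proof. by rewrite /hamming cardsE -sum1_card big_mkcond. Qed.

Definition single_letter (N : nat) (q : 'I_N -> nat) (i : 'I_N)
  (a : 'Z_(q i)) : word q :=
  [ffun j => dfwith (fun j => 0%R : 'Z_(q j)) a j].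

Lemma single_letter_in (N : nat) (q : 'I_N -> nat) (i : 'I_N) (a : 'Z_(q i)) :
  single_letter N q i a i = a.
Proof. by rewrite ffunE dfwith_in. Qed.

Lemma single_letter_out (N : nat) (q : 'I_N -> nat) (i j : 'I_N)
  (a : 'Z_(q i)) : i != j -> single_letter N q i a j = 0%R.
Proof. by move=> ij; rewrite ffunE dfwith_out. Qed.

Lemma weight_single_letter (N : nat) (q : 'I_N -> nat) (i : 'I_N)
  (a : 'Z_(q i)) : weight (single_letter N q i a) = (a != 0%R).
Proof.
rewrite weightE (bigD1 i) //= single_letter_in big1 ?addn0 // => j ji.
by rewrite single_letter_out ?eqxx // eq_sym.
Qed.

Lemma weight1P (N : nat) (q : 'I_N -> nat) (x : word q) : weight x = 1 ->
  exists (i : 'I_N) (a : 'Z_(q i)), a != 0%R /\ x = single_letter N q i a.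
Proof.
move=> /eqP /cards1P[i Ei]; exists i, (x i).
have xE j : (x j != 0%R) = (j == i) by have /setP /(_ j) := Ei; rewrite !inE.
split; first by rewrite xE.
apply/ffunP => j; have [->|ji] := eqVneq j i; first by rewrite single_letter_in.
by rewrite single_letter_out 1?eq_sym //; apply/eqP/negPn; rewrite xE (negbTE ji).
Qed.

(** Away from [i] the single letter is zero, so there the distance counts the nonzero letters of
    [c]. Both corrections at [i] are added, which avoids truncated subtraction. *)
Lemma hamming_single_letter (N : nat) (q : 'I_N -> nat) (i : 'I_N)
  (a : 'Z_(q i)) (c : word q) :
  hamming (single_letter N q i a) c + (c i != 0%R) = weight c + (a != c i).
Proof.
rewrite hammingE weightE (bigD1 i) //= [in RHS](bigD1 i) //= single_letter_in.
rewrite (eq_bigr (fun j => nat_of_bool (c j != 0%R))). 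
  by rewrite addnC [(a != _) + _]addnC addnA.
by move=> j ji; rewrite single_letter_out 1?eq_sym.
Qed.

Lemma hamming_single_letter_eq (N : nat) (q : 'I_N -> nat) (k : nat)
  (i : 'I_N) (a : 'Z_(q i)) (c : word q) : 0 < k -> a != 0%R -> weight c = k ->
  hamming (single_letter N q i a) c = k - 1 <-> c i = a.
Proof.
move=> k0 a0 wc; have := hamming_single_letter N q i a c; rewrite wc.
have [<-|ac] := eqVneq a (c i); first by rewrite a0; split=> //; lia.
by split=> [|ca]; [lia | rewrite ca eqxx in ac].
Qed.

Lemma mixed_steiner_letter (N : nat) (q : 'I_N -> nat) (k : nat)
  (C : {set word q}) (i : 'I_N) (a : 'Z_(q i)) : 0 < k ->
  mixed_steiner 1 k C -> a != 0%R -> exists! c : word q, c \in C /\ c i = a.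
Proof.
move=> k0 [wC covC _] a0.
have [|c [[cC /hamming_single_letter_eq ca] cU]] := covC (single_letter N q i a).
  by rewrite weight_single_letter a0.
exists c; split=> [|c' [c'C c'a]]; first by split=> //; apply: ca (wC _ cC).
by apply: cU; split=> //; apply/hamming_single_letter_eq => //; apply: wC.
Qed.

(** Evaluation at [i] is a bijection from the codewords that are nonzero at [i] onto the nonzero
    letters of ['Z_(q i)]. *)
Lemma card_letter (N : nat) (q : 'I_N -> nat) (C : {set word q}) (i : 'I_N) :
  1 < q i ->
  (forall a : 'Z_(q i), a != 0%R -> exists! c : word q, c \in C /\ c i = a) ->
  \sum_(c in C) (c i != 0%R) = q i - 1.
Proof.
move=> qi CP; rewrite -big_mkcondr sum1_card /=.
pose D : {set word q} := [set c in C | c i != 0%R].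
have -> : #|[pred c in C | c i != 0%R]| = #|D| by rewrite cardsE.
rewrite -(card_in_imset (f := fun c : word q => c i)) => [|c c']; last first.
  rewrite !inE => /andP[cC c0] /andP[c'C _] cc'.
  by have [d [_ dU]] := CP _ c0; rewrite -(dU c) ?(dU c').
have -> : [set c i | c : word q in D] = [set~ 0%R].
  apply/setP => a; rewrite !inE; apply/imsetP/idP => [[c]|a0].
    by rewrite inE => /andP[_ c0] ->.
  by have [c [[cC ca] _]] := CP _ a0; exists c; rewrite // inE cC ca.
by rewrite cardsC1 card_ord Zp_cast // subn1.
Qed.

Lemma binary_letter_unique (m : nat) (a b : 'Z_m) :
  m = 2 -> a != 0%R -> b != 0%R -> a = b.
Proof.
move=> m2; subst m.
by case: a b => [[|[|a]] ia] [[|[|b]] ib] //= _ _; apply/val_inj.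
Qed.

Lemma binary_and_one_gt1 (n q : nat) (i : 'I_n.+1) :
  1 < q -> 1 < binary_and_one n q i.
Proof. by rewrite /binary_and_one; case: ifP. Qed.

Lemma mixed_steiner_of_letters (n q k : nat)
  (C : {set word (binary_and_one n q)}) : 0 < k ->
  (forall c : word (binary_and_one n q), c \in C -> weight c = k) ->
  (forall (i : 'I_n.+1) (a : 'Z_(binary_and_one n q i)), a != 0%R ->
    exists! c : word (binary_and_one n q), c \in C /\ c i = a) ->
  mixed_steiner 1 k C.
Proof.
move=> k0 wC CP; split=> // [x /weight1P[i [a [a0 ->]]] | c c' cC c'C cc'].
  have [c [[cC ca] cU]] := CP i a a0.
  exists c; split=> [|c' [c'C /hamming_single_letter_eq c'a]].
    by split=> //; apply/hamming_single_letter_eq => //; apply: wC.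
  by apply: cU; split=> //; apply: c'a (wC _ c'C).
suff: weight c + weight c' <= hamming c c' + 1 by rewrite !wC //; lia.
(* Written as the indicator of the last position, the defect 1 turns the bound into a coordinatewise
   inequality: two distinct codewords can both be nonzero only at that position. *)
have -> : 1 = \sum_(i < n.+1) (i == ord_max).
  by rewrite -big_mkcond /= big_pred1_eq.
rewrite !weightE hammingE -!big_split /=; apply: leq_sum => i _.
have neq a : a != 0%R -> c i = a -> c' i = a -> False.
  move=> a0 ca c'a; have [d [_ dU]] := CP i a a0.
  by move: cc'; rewrite -(dU c) // -(dU c') // eqxx.
case: (eqVneq (c i) 0%R) => [->|ci0].
  by rewrite [_ == c' i]eq_sym; apply: leq_addr.
have [eqc|_] := eqVneq (c i) (c' i); first by case: (neq _ ci0).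
have [|c'i0] := eqVneq (c' i) 0%R; first by case: (i == ord_max).
have [//|imax] := eqVneq i ord_max.
have lt_in : i < n by move: imax (ltn_ord i); rewrite -val_eqE /=; lia.
case: (neq _ ci0 erefl); apply: binary_letter_unique => //.
by rewrite /binary_and_one lt_in.
Qed.

Lemma mixed_steiner_bounds (n q k : nat)
  (C : {set word (binary_and_one n q)}) : 1 < q -> 0 < k ->
  mixed_steiner 1 k C ->
  (k - 1) * (q - 1) <= n /\ k %| n - (k - 1) * (q - 1).
Proof.
move=> q1 k0 SC; have [wC _ _] := SC.
have cardC i : \sum_(c in C) (c i != 0%R) = binary_and_one n q i - 1.
  apply: card_letter => [|a]; first exact: binary_and_one_gt1.
  exact: mixed_steiner_letter SC.
have cardn (i : 'I_n) : \sum_(c in C) (c (widen_ord (leqnSn n) i) != 0%R) = 1.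
  by rewrite cardC /binary_and_one /= ltn_ord.
have cardq : \sum_(c in C) (c ord_max != 0%R) = q - 1.
  by rewrite cardC /binary_and_one /= ltnn.
have weight_split (c : word (binary_and_one n q)) : c \in C ->
    \sum_(i < n) (c (widen_ord (leqnSn n) i) != 0%R) + (c ord_max != 0%R) = k.
  by move=> cC; rewrite -(wC c cC) weightE big_ord_recr.
(* Double counting of the nonzero letters, by codewords and by positions. *)
have total : #|C| * k = n + (q - 1).
  rewrite -sum_nat_const -(eq_bigr _ weight_split) big_split /= cardq.
  rewrite exchange_big /= (eq_bigr (fun=> 1)) => [|i _]; last exact: cardn.
  by rewrite sum1_card card_ord.
have bound : (k - 1) * (q - 1) <= n.
  rewrite -cardq big_distrr /=.
  have countn : \sum_(i < n) \sum_(c in C)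
      (c (widen_ord (leqnSn n) i) != 0%R) = n.
    rewrite (eq_bigr (fun=> 1)) => [|i _]; last exact: cardn.
    by rewrite sum1_card card_ord.
  (* Termwise in [c]: a codeword that is nonzero at the last position has exactly [k - 1] nonzero
     binary letters. *)
  rewrite -[leqRHS]countn exchange_big /=; apply: leq_sum => c cC.
  rewrite -(weight_split c cC); case: (c ord_max != 0%R); last by rewrite muln0.
  by rewrite muln1 addnK.
(* The witness is the number of codewords that vanish at the last position. *)
split=> //; apply/dvdnP; exists (#|C| - (q - 1)).
by rewrite !mulnBl total mul1n; nia.
Qed.

(** Division by [k] cuts the interval into [s] runs of length [k]. The case of length 0 occurs
    below, where the run length is [k - 1] and [k] may be 1. *)
Lemma sum_divn_eq (k s j : nat) :
  \sum_(0 <= i < k * s) (i %/ k == j) = if j < s then k else 0.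
Proof.
elim: s => [|s IHs]; first by rewrite muln0 big_geq.
have [->|k0] := posnP k; first by rewrite mul0n big_geq //; case: ifP.
rewrite (big_cat_nat (n := k * s)) //= ?leq_mul // IHs.
rewrite -{1}[k * s]add0n big_addn (_ : k * s.+1 - k * s = k); last by nia.
rewrite (eq_big_nat _ _ (F2 := fun=> nat_of_bool (s == j))) => [|i /andP[_ ik]].
  by rewrite sum_nat_const_nat subn0; case: (ltngtP j s) => ?; case: ltnP; lia.
by rewrite addnC mulnC divnMDl // (divn_small ik) addn0.
Qed.

(* The first [q - 1] blocks have room for one letter of the last position. *)
Definition binary_block (q k i : nat) : nat :=
  if i < (k - 1) * (q - 1) then i %/ (k - 1)
  else q - 1 + (i - (k - 1) * (q - 1)) %/ k.

Lemma sum_binary_block (q k s j : nat) : j < q - 1 + s ->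
  \sum_(0 <= i < (k - 1) * (q - 1) + k * s) (binary_block q k i == j) =
  k - (j < q - 1).
Proof.
move=> js; rewrite (big_cat_nat (n := (k - 1) * (q - 1))) ?leq_addr //=.
rewrite (eq_big_nat _ _ (F2 := fun i => nat_of_bool (i %/ (k - 1) == j))).
  rewrite sum_divn_eq -{1}[(k - 1) * (q - 1)]add0n big_addn addKn.
  (* The guard is needed because [j - (q - 1)] truncates to 0 for every smaller [j]. *)
  rewrite (eq_bigr (fun i => nat_of_bool ((j >= q - 1) && (i %/ k == j - (q - 1))))).
    case: ltnP => jq; first by rewrite big1 ?addn0.
    by rewrite /= sum_divn_eq ifT; lia.
  move=> i _; rewrite /binary_block ltnNge leq_addl addnK /=; congr nat_of_bool.
  by move: (i %/ k) => d; lia.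
by move=> i /andP[_ ilt]; rewrite /binary_block ilt.
Qed.

(** At the last position, blocks [0] to [q - 2] receive the letters [1] to [q - 1], each once; the
    other blocks receive 0. *)
Definition block_letter (n q k j i : nat) : nat :=
  if i < n then (binary_block q k i == j : nat)
  else if j < q - 1 then j.+1 else 0.

Definition block_word (n q k j : nat) : word (binary_and_one n q) :=
  [ffun i : 'I_n.+1 => inZp (block_letter n q k j i)].

Definition letter_block (n q k i a : nat) : nat :=
  if i < n then binary_block q k i else a.-1.

Lemma val_block_word (n q k j : nat) (i : 'I_n.+1) : 1 < q ->
  block_word n q k j i = block_letter n q k j i :> nat.
Proof.
move=> q1; rewrite ffunE /= Zp_cast ?binary_and_one_gt1 // modn_small //.
rewrite /binary_and_one /block_letter; case: ifP => _; first by case: eqP.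
by case: ifP; lia.
Qed.

Lemma letter_bounds (m : nat) (a : 'Z_m) : 1 < m -> a != 0%R -> 0 < a < m.
Proof.
by move=> m1 a0; have := ltn_ord a; rewrite {2}Zp_cast // => ->; rewrite lt0n a0.
Qed.

(** This is the partition property: [letter_block] names the one block that contains a given nonzero
    letter, which yields both existence and uniqueness of the codeword. *)
Lemma block_word_eq (n q k j : nat) (i : 'I_n.+1)
  (a : 'Z_(binary_and_one n q i)) : 1 < q -> a != 0%R ->
  block_word n q k j i = a <-> j = letter_block n q k i a.
Proof.
move=> q1 a0; have -> : block_word n q k j i = a <-> block_letter n q k j i = a.
  by rewrite -val_block_word //; split=> [->|/val_inj].
have /andP[] := letter_bounds _ _ (binary_and_one_gt1 n q i q1) a0.
move: (nat_of_ord a) => b.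
rewrite /binary_and_one /block_letter /letter_block.
by case: ifP => _ b0 bq; [case: eqP | case: ltnP]; lia.
Qed.

Lemma weight_block_word (n q k s j : nat) : 1 < q -> 0 < k ->
  n = (k - 1) * (q - 1) + k * s -> j < q - 1 + s ->
  weight (block_word n q k j) = k.
Proof.
move=> q1 k0 nE js.
have -> : weight (block_word n q k j) =
    \sum_(i < n.+1) (block_letter n q k j i != 0).
  by rewrite weightE; apply: eq_bigr => i _; rewrite -val_eqE /= val_block_word.
rewrite big_ord_recr /= {2}/block_letter ltnn.
rewrite (eq_bigr (fun i : 'I_n => nat_of_bool (binary_block q k i == j))).
  rewrite -(big_mkord xpredT (fun i => nat_of_bool (binary_block q k i == j))).
  (* The binary letter that the first [q - 1] blocks lack is made up for by their nonzero last
     letter. *)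
  by rewrite {1}nE sum_binary_block //; case: ifP => _ /=; lia.
by move=> i _; rewrite /block_letter ltn_ord; case: (_ == j).
Qed.

Lemma letter_block_lt (n q k s : nat) (i : 'I_n.+1)
  (a : 'Z_(binary_and_one n q i)) : 1 < q -> 0 < k ->
  n = (k - 1) * (q - 1) + k * s -> a != 0%R ->
  letter_block n q k i a < q - 1 + s.
Proof.
move=> q1 k0 nE a0.
have /andP[] := letter_bounds _ _ (binary_and_one_gt1 n q i q1) a0.
move: (nat_of_ord a) => b.
rewrite /binary_and_one /letter_block; case: (ltnP i n) => [lt_in _ _|_]; last by lia.
rewrite /binary_block; case: (ltnP i ((k - 1) * (q - 1))) => ib.
  (* The divisor [k - 1] is positive here, since [ib] places [i] below a multiple of it. *)
  by apply: ltn_addr; rewrite ltn_divLR 1?mulnC //; nia.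
by rewrite ltn_add2l ltn_divLR // mulnC; lia.
Qed.

Lemma mixed_steiner_exists (n q k s : nat) : 1 < q -> 0 < k ->
  n = (k - 1) * (q - 1) + k * s ->
  mixed_steiner 1 k [set block_word n q k j | j : 'I_(q - 1 + s)].
Proof.
move=> q1 k0 nE; apply: mixed_steiner_of_letters => // [c /imsetP[j _ ->] | i a a0].
  exact: weight_block_word nE (ltn_ord j).
have blt := letter_block_lt n q k s i a q1 k0 nE a0.
exists (block_word n q k (letter_block n q k i a)); split=> [|c [/imsetP[j _ ->]]].
  by split; [apply/imsetP; exists (Ordinal blt) | apply/block_word_eq].
by move=> /block_word_eq -> //.
Qed.

Theorem theorem5 (n q k : nat) (hn : 1 <= n) (hq : 2 <= q)
    (hk : 1 <= k <= n.+1) :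
  (exists C : {set word (binary_and_one n q)}, mixed_steiner 1 k C) <->
  ((k - 1) * (q - 1) <= n /\ k %| n - (k - 1) * (q - 1)).
Proof.
have /andP[k0 _] := hk.
split=> [[C]|[le_n /dvdnP[s sE]]]; first exact: mixed_steiner_bounds.
(* There are [q - 1] codewords that use the last position and [s], the quotient in the divisibility,
   that do not. *)
exists [set block_word n q k j | j : 'I_(q - 1 + s)].
by apply: mixed_steiner_exists => //; rewrite mulnC [k * s]mulnC -sE mulnC subnKC.
Qed.
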